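(* Let $p$ be a prime, $l\ge 0$ an integer, $q=p^l$, and let $k$ be an integer with $0\le k\le q/2$. For $n\ge0$ let $P(n)$ denote the $n\times n$ matrix with entries $\binom{i+j}{i}$, $0\le i,j<n$, and let $\chi_n(t)=\det(tI(n)-P(n))$. Then $$\chi_{q-k}(t)\equiv (t^2+t+1)^{(q-\epsilon(q))/3-k}\,(t-1)^{(q+2\epsilon(q))/3-k}\,\det(t^2I(k)+P(k))\pmod p,$$ where $\epsilon(q)\in\{-1,0,1\}$ is defined by $\epsilon(q)\equiv q\pmod 3$.
   Context: $I(n)$ is the $n\times n$ identity matrix; the determinant of a $0\times 0$ matrix is $1$. The congruence is coefficientwise in $\mathbf{Z}[t]$. *)

(* Defs.v *)
From HB Require Import structures.
From mathcomp Require Import all_boot all_order all_algebra.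
Set Implicit Arguments. Unset Strict Implicit. Unset Printing Implicit Defensive.
Import Order.TTheory GRing.Theory Num.Theory.
Local Open Scope ring_scope.

Definition Pmat (n : nat) : 'M[int]_n := \matrix_(i < n, j < n) ('C(i + j, i))%:Z.

(* chi_n(t) = det(t I(n) - P(n)) (MathComp's char_poly; det of 0x0 matrix is 1) *)
Definition chi (n : nat) : {poly int} := char_poly (Pmat n).

Definition D (k : nat) : {poly int} :=
  \det ((('X ^+ 2) %:M : 'M[{poly int}]_k) + map_mx polyC (Pmat k)).

Definition eps (q : nat) : int :=
  if (q %% 3 == 2)%N then -1 else ((q %% 3)%N)%:Z.

(* exponents (q - eps(q))/3 - k and (q + 2 eps(q))/3 - k (exact divisions) *)
Definition expA (q k : nat) : int := ((q%:Z - eps q) %/ 3)%Z - k%:Z.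
Definition expB (q k : nat) : int := ((q%:Z + 2 * eps q) %/ 3)%Z - k%:Z.

Definition posp (e : int) : nat := if e is Posz n then n else 0%N.
Definition negp (e : int) : nat := if e is Negz n then n.+1 else 0%N.

Definition cong_mod (p : nat) (f g : {poly int}) : Prop :=
  forall i : nat, (p%:Z %| (f - g)`_i)%Z.

(* Main.v *)
(* Modulo p, with q = p^l, the q x q Pascal matrix M is the matrix of the
   substitution f |-> (1 - X)^(q-1) f(1 / (1 - X)) on polynomials of
   degree < q. The homography 1 / (1 - X) has order 3,
   so M^3 = 1, and its fixed points are the -w with w^2 + w + 1 = 0, which gives the
   eigenvalues w^(2(q-1)-i) of M and the case k = 0. For general k, the matrix of
   size q-k is a corner of M, and the characteristic polynomial of a corner is
   that of M times the complementary minor of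
   (t - M)^-1 = (t^2 + t M + M^2) / (t^3 - 1), which is D_k / (t^3 - 1)^k. *)
Require Import Defs.
From HB Require Import structures.
From mathcomp Require Import all_boot all_order all_algebra all_field.
From mathcomp Require Import ring zify.
Import Order.TTheory GRing.Theory Num.Theory.
Local Open Scope ring_scope.

(** * Powers of linear forms and homogeneous substitution *)

Lemma coef_linear_exp (R : comNzRingType) (a b : R) (m j : nat) :
  ((a%:P + b%:P * 'X) ^+ m)`_j = (a ^+ (m - j) * b ^+ j) *+ 'C(m, j).
Proof.
have -> : (a%:P + b%:P * 'X) ^+ m
        = \poly_(l < m.+1) ((a ^+ (m - l) * b ^+ l) *+ 'C(m, l)).
  rewrite exprDn poly_def; apply: eq_bigr => l _.
  by rewrite exprMn -!polyC_exp mulrA -polyCM -mul_polyC polyCMn mulrnAl.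
by rewrite coef_poly ltnS; case: leqP => // /bin_small ->; rewrite mulr0n.
Qed.

(* Row i of the Pascal matrix mod p lists the coefficients of (1 - X)^(q-1-i), so
   that multiplying by it is the substitution 1 := d, X := c, homogenized in
   degree q-1, in the polynomial coding a row. *)
Lemma homogeneous_subst (R : comNzRingType) (a b : R) (c d : {poly R}) (q m : nat) :
  (m < q)%N ->
  \sum_(l < q) ((a%:P + b%:P * 'X) ^+ m)`_l *: (c ^+ l * d ^+ (q.-1 - l))
    = d ^+ (q.-1 - m) * (a%:P * d + b%:P * c) ^+ m.
Proof.
move=> ltmq; rewrite [in RHS]exprDn mulr_sumr.
rewrite (big_ord_widen q (fun l => d ^+ (q.-1 - m) *
  (((a%:P * d) ^+ (m - l) * (b%:P * c) ^+ l) *+ 'C(m, l)))) // [RHS]big_mkcond /=.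
apply: eq_bigr => l _; rewrite coef_linear_exp ltnS.
case: leqP => [lelm|/bin_small ->]; last by rewrite mulr0n scale0r.
have -> : (q.-1 - l = (q.-1 - m) + (m - l))%N by lia.
rewrite -mul_polyC polyCMn polyCM !polyC_exp !exprMn exprD mulrnAl mulrnAr; congr (_ *+ _); ring.
Qed.

(** * The Pascal matrix in characteristic p *)

Section PascalModP.
Variables (K : fieldType) (q : nat).
Hypothesis (nq : [pchar K].-nat q).
Local Notation u := ((1 : K)%:P + (-1)%:P * 'X).

Lemma pchar_nat_gt0 : (0 < q)%N.
Proof. by case/andP: nq. Qed.

Lemma sign_exp_pred : (-1) ^+ q.-1 = 1 :> K.
Proof.
have := exprNn_pchar 1 nq; rewrite -{1}(prednK pchar_nat_gt0) exprS expr1n mulN1r.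
exact: oppr_inj.
Qed.

(** By Frobenius u^q = 1 - X^q, and dividing by u leaves the geometric sum. *)
Lemma coef_one_sub_exp_pred j : (j < q)%N -> (u ^+ q.-1)`_j = 1.
Proof.
move=> ltjq; have q0 := pchar_nat_gt0.
have nqP : [pchar {poly K}].-nat q by rewrite (eq_pnat _ (pchar_poly K)).
have u0 : u != 0.
  by apply/eqP => /(congr1 (fun f : {poly K} => f`_0)) /eqP;
     rewrite coefD coefC coefCM coefX mulr0 addr0 coef0 oner_eq0.
have -> : u ^+ q.-1 = \sum_(i < q) 'X^i; last first.
  under eq_bigr do rewrite -['X^_]scale1r.
  by rewrite -(poly_def q (fun=> 1)) coef_poly ltjq.
apply: (mulfI u0); rewrite -exprS prednK //.
rewrite exprDn_pchar // polyCN !polyC1 !mulN1r expr1n exprNn_pchar //.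
by rewrite -opprB subrX1 -mulNr opprB.
Qed.

(** Below degree q, u^(q-1-i) agrees with (1 - X)^(-i-1); removing one factor u is Pascal's rule. *)
Lemma coef_one_sub_exp i j : (i < q)%N -> (j < q)%N ->
  (u ^+ (q.-1 - i))`_j = ('C(i + j, i))%:R.
Proof.
elim: i j => [|i IHi] j ltiq ltjq.
  by rewrite subn0 coef_one_sub_exp_pred // bin0.
elim: j ltjq => [|j IHj] ltjq.
  by rewrite coef_linear_exp bin0 addn0 binn expr1n mul1r expr0.
rewrite addSn addnS binS natrD.
have:= IHi j.+1 (ltnW ltiq) ltjq; rewrite addnS => <-.
have:= IHj (ltnW ltjq); rewrite addSn => <-.
have -> : (q.-1 - i = (q.-1 - i.+1).+1)%N by lia.
by rewrite exprSr mulrDr mulr1 coefD [in X in _ + (_ + X)]mulrCA coefCM coefMX /=; ring.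
Qed.

Definition pascal_mx n : 'M[K]_n := \matrix_(i < n, j < n) ('C(i + j, i))%:R.
Local Notation M := (pascal_mx q).

Lemma mulmx_coef (A B : 'M[K]_q) (g : nat -> {poly K}) i j :
  (forall l, B l j = (g l)`_j) -> (A *m B) i j = (\sum_(l < q) A i l *: g l)`_j.
Proof. by move=> Bg; rewrite mxE coef_sum; apply: eq_bigr => l _; rewrite coefZ Bg. Qed.

Lemma pascal_mxE (i j : 'I_q) : M i j = (u ^+ (q.-1 - i))`_j.
Proof. by rewrite mxE coef_one_sub_exp. Qed.

(** Composing 1 / (1 - X) with itself gives (1 - X) / (-X); row i codes its i-th power, homogenized
    in degree q-1. *)
Lemma pascal_mx_sqr (i j : 'I_q) :
  (M *m M) i j = (u ^+ i * (- 'X) ^+ (q.-1 - i))`_j.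
Proof.
rewrite (@mulmx_coef _ _ (fun l => 1 ^+ l * u ^+ (q.-1 - l))); last first.
  by move=> l; rewrite expr1n mul1r pascal_mxE.
under eq_bigr do rewrite pascal_mxE.
rewrite homogeneous_subst; last by have := ltn_ord i; lia.
have -> : (q.-1 - (q.-1 - i) = i)%N by have := ltn_ord i; lia.
by have -> : (1 : K)%:P * u + (-1)%:P * 1 = - 'X by rewrite polyCN polyC1; ring.
Qed.

Lemma pascal_mx_cube : M *m (M *m M) = 1%:M.
Proof.
apply/matrixP => i j.
rewrite (@mulmx_coef _ _ (fun l => u ^+ l * (- 'X) ^+ (q.-1 - l))); last first.
  by move=> l; rewrite pascal_mx_sqr.
under eq_bigr do rewrite pascal_mxE.
have ltiq := ltn_ord i.
rewrite homogeneous_subst; last lia.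
have -> : (q.-1 - (q.-1 - i) = i)%N by lia.
have -> : (1 : K)%:P * - 'X + (-1)%:P * u = -1 by rewrite polyCN polyC1; ring.
have -> : (- 'X) ^+ i * (-1) ^+ (q.-1 - i) = 'X^i :> {poly K}.
  rewrite (exprNn 'X) mulrAC -exprD subnKC; last lia.
  by rewrite -polyC1 -polyCN -polyC_exp sign_exp_pred polyC1 mul1r.
by rewrite coefXn mxE eq_sym.
Qed.

End PascalModP.

(** * Complementary minors and corners of the Pascal matrix *)

(* Jacobi's complementary minor formula, with W = c N^-1. *)
Lemma det_ulsubmx (R : comNzRingType) (n k : nat) (N W : 'M[R]_(n + k)) (c : R) :
  N *m W = c%:M -> \det (ulsubmx N) * c ^+ k = \det N * \det (drsubmx W).
Proof.
move=> NW.
have eN : N *m block_mx 1%:M (ursubmx W) 0 (drsubmx W)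
        = block_mx (ulsubmx N) 0 (dlsubmx N) c%:M.
  move: NW; rewrite -{1 2}[N]submxK -{1}[W]submxK !mulmx_block scalar_mx_block.
  by case/eq_block_mx => _ -> _ ->; rewrite !mulmx1 !mulmx0 !addr0.
by rewrite -(det_scalar k c) -(det_lblock _ (dlsubmx N)) -eN det_mulmx det_ublock det1 mul1r.
Qed.

Lemma det_rev (R : comNzRingType) (n : nat) (A : 'M[R]_n) :
  \det (\matrix_(i, j) A (rev_ord i) (rev_ord j)) = \det A.
Proof.
pose s := perm.perm (@rev_ord_inj n).
have -> : \matrix_(i, j) A (rev_ord i) (rev_ord j) = row_perm s (col_perm s A).
  by apply/matrixP => i j; rewrite !mxE !perm.permE.
by rewrite row_permE col_permE !det_mulmx !det_perm perm.odd_permV mulrCA -signr_addb addbb mulr1.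
Qed.

(* Since M^3 = 1, the inverse of X - M is (X^2 + X M + M^2) / (X^3 - 1). Its lower
   right block is computed from those of M, which vanishes, and of M^2, which
   is the k x k Pascal matrix with both index orders reversed. *)
Lemma char_poly_pascal_schur (K : fieldType) (n k : nat) :
  [pchar K].-nat (n + k)%N -> (k <= n)%N ->
  char_poly (pascal_mx K n) * ('X^3 - 1) ^+ k
    = char_poly (pascal_mx K (n + k))
      * \det (('X^2)%:M + map_mx polyC (pascal_mx K k)).
Proof.
move=> nq lekn; set M := pascal_mx K (n + k).
pose M' := map_mx polyC M.
pose W := ('X^2)%:M + 'X *: M' + M' *m M'.
have NW : char_poly_mx M *m W = ('X^3 - 1)%:M.
  have M3 : M' *m (M' *m M') = 1%:M by rewrite -!map_mxM pascal_mx_cube // map_mx1.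
  rewrite mulmxBl mul_scalar_mx /W !mulmxDr -/M' M3 -scalemxAr mul_mx_scalar !scalerDr.
  rewrite scale_scalar_mx scalerA -!exprS -expr2 raddfB /= opprD opprD !addrA.
  by rewrite [X in X - _ - _]addrAC !addrK.
have := det_ulsubmx _ _ _ _ _ _ NW; rewrite -/(char_poly M).
have -> : ulsubmx (char_poly_mx M) = char_poly_mx (pascal_mx K n).
  by apply/matrixP => i j; rewrite !mxE.
rewrite -/(char_poly _) => ->; congr (_ * _).
rewrite -[RHS]det_rev; congr (\det _); apply/matrixP => i j.
have := ltn_ord i; have := ltn_ord j => ltj lti.
have -> : drsubmx W i j = ('X^2)%:M i j + 'X * (M (rshift n i) (rshift n j))%:P
     + ((M *m M) (rshift n i) (rshift n j))%:P.
  have -> : W = ('X^2)%:M + 'X *: M' + map_mx polyC (M *m M) by rewrite map_mxM.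
  by move: (M *m M) => M2; rewrite !mxE eq_rshift.
(* The entry is the coefficient of X^(n+j) in (1 - X)^(k-1-i), whose degree is below k <= n. *)
have M0 : M (rshift n i) (rshift n j) = 0.
  by rewrite pascal_mxE // coef_linear_exp bin_small ?mulr0n //=; lia.
have -> : (M *m M) (rshift n i) (rshift n j) = pascal_mx K k (rev_ord i) (rev_ord j).
  rewrite pascal_mx_sqr //= mxE /=.
  set a := (k - i.+1)%N; set b := (k - j.+1)%N.
  have -> : ((n + k).-1 - (n + i) = a)%N by lia.
  rewrite (exprNn 'X) mulrA coefMXn ltnNge (_ : (a <= n + j)%N) /=; last lia.
  rewrite -polyC1 -polyCN -polyC_exp coefMC coef_linear_exp expr1n mul1r.
  (* Since n+i = q-1-a with q = n+k, the target entry is coefficient b of (1 - X)^(n+i). Binomial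
     symmetry matches it with coefficient (n+i)-b, and the signs differ by (-1)^(q-1) = 1. *)
  rewrite -(coef_one_sub_exp _ _ nq a b); [|lia|lia].
  have -> : ((n + k).-1 - a = n + i)%N by lia.
  rewrite coef_linear_exp expr1n mul1r mulrnAl -exprD.
  have -> : (n + j - a = (n + i) - b)%N by lia.
  rewrite bin_sub; last lia.
  congr (_ *+ _); rewrite -[RHS]mulr1 -[X in _ * X](sign_exp_pred _ _ nq) -exprD.
  by rewrite -signr_odd -[RHS]signr_odd; congr (_ ^+ nat_of_bool _); lia.
rewrite M0 polyC0 mulr0 addr0.
by move: (pascal_mx K k) => P; rewrite !mxE (inj_eq rev_ord_inj).
Qed.

(** * Cube roots of unity and the case k = 0 *)

Lemma cube_root_sqr (R : comNzRingType) (w : R) :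
  w ^+ 2 + w + 1 = 0 -> w ^+ 2 = - w - 1.
Proof. by move=> w0; apply/eqP; rewrite -subr_eq0 !opprD !opprK addrA w0. Qed.

Lemma cube_root_cube (R : comNzRingType) (w : R) : w ^+ 2 + w + 1 = 0 -> w ^+ 3 = 1.
Proof. by move=> /cube_root_sqr w2; rewrite exprS w2 mulrBr mulrN -expr2 w2; ring. Qed.

Lemma cube_root_sqrC (R : comNzRingType) (w : R) :
  w ^+ 2 + w + 1 = 0 -> w%:P ^+ 2 = - w%:P - 1.
Proof. by move=> /cube_root_sqr w2; rewrite -polyC_exp w2 polyCB polyCN polyC1. Qed.

(** Over a domain, [\det T] is cancelled instead of inverting [T]. The transpose appears because
    [is_trig_mx] means lower triangular. *)
Lemma char_poly_triangular_conj (R : idomainType) (n : nat) (T A U : 'M[R]_n) :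
  \det T != 0 -> T *m A = U *m T -> is_trig_mx U^T ->
  char_poly A = \prod_(i < n) ('X - (U i i)%:P).
Proof.
move=> T0 TA trigU.
have -> : \prod_(i < n) ('X - (U i i)%:P) = char_poly U.
  transitivity (char_poly U^T).
    by rewrite char_poly_trig //; apply: eq_bigr => i _; rewrite mxE.
  rewrite /char_poly -det_tr; congr (\det _); apply/matrixP => i j.
  by rewrite !mxE eq_sym.
have T'0 : \det (map_mx polyC T) != 0 by rewrite det_map_mx polyC_eq0.
apply: (mulfI T'0); rewrite [RHS]mulrC -!det_mulmx; congr (\det _).
by rewrite mulmxBr mulmxBl -!map_mxM TA mul_mx_scalar mul_scalar_mx.
Qed.

(* In the basis (X + w)^i the substitution f |-> (1 - X)^(q-1) f(1 / (1 - X)) is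
   upper triangular, because -w is a fixed point of 1 / (1 - X). Unlike
   diagonalization, this also works in characteristic 3, where w = w^2 = 1. *)
Lemma char_poly_pascal (K : fieldType) (q : nat) (w : K) :
  [pchar K].-nat q -> w ^+ 2 + w + 1 = 0 ->
  char_poly (pascal_mx K q) = \prod_(i < q) ('X - (w ^+ (q.-1 + i))%:P).
Proof.
move=> nq w0; have q0 := pchar_nat_gt0 _ _ nq.
have w2P := cube_root_sqrC _ _ w0.
pose T := \matrix_(i < q, j < q) ((w%:P + 1%:P * 'X) ^+ i)`_j.
(* With Y = X + w, 1 + w(1 - X) = -w Y and 1 - X = -w^2 - Y, so [f i] is the image of Y^i written in
   the variable Y. *)
pose f i : {poly K} :=
  'X^i * ((- w) ^+ i *: ((- w ^+ 2)%:P + (-1)%:P * 'X) ^+ (q.-1 - i)).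
pose U := \matrix_(i < q, j < q) (f i)`_j.
have fE i j : (f i)`_j = if (j < i)%N then 0 else
   (- w) ^+ i * (((- w ^+ 2) ^+ (q.-1 - i - (j - i)) * (-1) ^+ (j - i)) *+ 'C(q.-1 - i, j - i)).
  by rewrite coefXnM coefZ coef_linear_exp.
rewrite (@char_poly_triangular_conj _ _ T _ U).
- rewrite (reindex_inj rev_ord_inj) /=; apply: eq_bigr => i _; have lti := ltn_ord i.
  congr (_ - _%:P); rewrite mxE fE /= ltnn subnn subn0 expr0 bin0 mulr1 mulr1n.
  have -> : (q.-1 - (q - i.+1) = i)%N by lia.
  rewrite -mulN1r -[- w ^+ 2]mulN1r !exprMn mulrACA -!exprD.
  have -> : (q - i.+1 + i = q.-1)%N by lia.
  by rewrite sign_exp_pred // mul1r; congr (_ ^+ _); lia.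
- rewrite det_trig; last first.
    apply/is_trig_mxP => i j ltij; rewrite mxE coef_linear_exp bin_small //.
  rewrite big1 ?oner_eq0 // => i _.
  by rewrite mxE coef_linear_exp binn subnn expr0 expr1n mul1r.
- apply/matrixP => i j; have lti := ltn_ord i.
  rewrite (@mulmx_coef _ _ _ _ (fun l => 1 ^+ l * (1%:P + (-1)%:P * 'X) ^+ (q.-1 - l)));
    last by move=> l; rewrite expr1n mul1r pascal_mxE.
  rewrite (@mulmx_coef _ _ _ _ (fun l => (w%:P + 1%:P * 'X) ^+ l));
    last by move=> l; rewrite mxE.
  congr (nth _ (polyseq _) _); under eq_bigr do rewrite mxE.
  under [RHS]eq_bigr do rewrite mxE.
  rewrite homogeneous_subst //.
  have -> : \sum_(l < q) (f i)`_l *: (w%:P + 1%:P * 'X) ^+ l = f i \Po (w%:P + 1%:P * 'X).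
    have {2}-> : f i = \poly_(l < q) (f i)`_l.
      apply/polyP => l; rewrite coef_poly; case: ltnP => // leql.
      by rewrite fE bin_small ?mulr0n ?mulr0 ?if_same //; lia.
    rewrite poly_def raddf_sum /=; apply: eq_bigr => l _.
    by rewrite comp_polyZ comp_Xn_poly.
  rewrite /f comp_polyM comp_Xn_poly comp_polyZ rmorphXn /= rmorphD rmorphM /= !comp_polyC comp_polyX.
  rewrite -mul_polyC polyC_exp mulrA -exprMn mulrC; congr (_ ^+ _ * _ ^+ _).
    rewrite !polyCN polyC1; have -> : (w%:P + 1 * 'X) * - w%:P = - w%:P ^+ 2 - w%:P * 'X by ring.
    by rewrite w2P; ring.
  by rewrite !polyCN polyC1 polyC_exp w2P; ring.
- apply/is_trig_mxP => i j ltij.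
  by rewrite !mxE fE ltij.
Qed.

(** Three consecutive factors multiply to X^3 - v^3 with v^3 = 1; expanding allows the roots to
    coincide. *)
Lemma prod_sub_cube_root (R : comNzRingType) (w : R) (e s : nat) :
  w ^+ 2 + w + 1 = 0 ->
  \prod_(i < s * 3) ('X - (w ^+ (e + i))%:P) = ('X^3 - 1) ^+ s.
Proof.
move=> w0; have w3 := cube_root_cube _ _ w0.
elim: s => [|s IHs]; first by rewrite big_ord0.
rewrite mulSn addnC !addnS addn0 !big_ord_recr /= IHs [RHS]exprSr -!mulrA; congr (_ * _).
set v := w ^+ (e + s * 3).
have v3 : v%:P ^+ 3 = 1 by rewrite -polyC_exp -exprM mulnC exprM w3 expr1n polyC1.
have w2P := cube_root_sqrC _ _ w0.
rewrite !addnS !exprSr -/v !polyCM -v3.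
transitivity ('X^3 - v%:P * (w%:P ^+ 2 + w%:P + 1) * 'X^2
  + v%:P ^+ 2 * (w%:P * (w%:P ^+ 2 + w%:P + 1)) * 'X - v%:P ^+ 3 * (w%:P * w%:P ^+ 2)); first ring.
have -> : w%:P * w%:P ^+ 2 = 1 by rewrite -exprS -polyC_exp w3.
by rewrite w2P; ring.
Qed.

(** After grouping by threes, the factors left over are none, X - 1, or (X - w)(X - w^2), according
    to q mod 3. *)
Lemma char_poly_pascal_cyclotomic (K : fieldType) (q a b : nat) (w : K) :
  [pchar K].-nat q -> w ^+ 2 + w + 1 = 0 ->
  q%:Z - eps q = 3 * a%:Z -> q%:Z + 2 * eps q = 3 * b%:Z ->
  char_poly (pascal_mx K q) = ('X^2 + 'X + 1) ^+ a * ('X - 1) ^+ b.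
Proof.
move=> nq w0 Ha Hb; rewrite (@char_poly_pascal _ _ w) //.
have w2 := cube_root_sqr _ _ w0.
have w3 := cube_root_cube _ _ w0.
have X3 : 'X^3 - 1 = ('X^2 + 'X + 1) * ('X - 1) :> {poly K} by ring.
have w3s s : w ^+ (s * 3) = 1 by rewrite mulnC exprM w3 expr1n.
have lt3 := ltn_pmod q (isT : (0 < 3)%N).
have := divn_eq q 3; move: Ha Hb lt3; rewrite /eps.
set s := (q %/ 3)%N; case: (q %% 3)%N => [|[|[|//]]] /= Ha Hb _ qE.
- have -> : a = s by lia. have -> : b = s by lia.
  by rewrite -exprMn -X3 qE addn0 prod_sub_cube_root.
- have -> : a = s by lia. have -> : b = s.+1 by lia.
  rewrite [X in _ * X]exprSr mulrA -exprMn -X3 qE addn1 /= big_ord_recr /= prod_sub_cube_root //.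
  by rewrite -mulnDl w3s.
- have -> : a = s.+1 by lia. have -> : b = s by lia.
  rewrite [X in X * _]exprSr mulrAC -exprMn -X3 qE addn2 /= !big_ord_recr /= prod_sub_cube_root //.
  rewrite -mulrA; congr (_ * _).
  have -> : ((s * 3).+1 + s * 3 = ((s + s) * 3).+1)%N by lia.
  have -> : ((s * 3).+1 + (s * 3).+1 = ((s + s) * 3).+2)%N by lia.
  rewrite !exprSr w3s !mul1r -expr2 w2 polyCB polyCN polyC1.
  have w2P := cube_root_sqrC _ _ w0.
  transitivity ('X^2 + 'X - (w%:P ^+ 2 + w%:P)); first ring.
  by rewrite w2P; ring.
Qed.

(** * From the field back to the integers *)

Lemma exists_cube_root_field (p : nat) : prime p ->
  exists (K : fieldType) (w : K), p \in [pchar K] /\ w ^+ 2 + w + 1 = 0.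
Proof.
move=> pr_p; have [K [f _]] := countable_algebraic_closure 'F_p.
(* The constant coefficients -1 encode w^2 = -1 - w. *)
have [w w2] := @solve_monicpoly K 2 (fun=> -1) isT.
exists K, w; split; first by rewrite (fmorph_pchar f) pchar_Fp.
by rewrite w2 !big_ord_recl big_ord0 expr0; ring.
Qed.

(* chi_{q-k} = (t^2+t+1)^A (t-1)^B D_k  (mod p), with possibly negative A, B,
   stated after clearing denominators: negative-exponent factors are moved
   to the left-hand side. *)
Theorem theorem1p3 (p l k : nat) :
  prime p -> (2 * k <= p ^ l)%N ->
  cong_mod p
    (chi (p ^ l - k) * ('X ^+ 2 + 'X + 1) ^+ negp (expA (p ^ l) k)
                     * ('X - 1) ^+ negp (expB (p ^ l) k))
    (('X ^+ 2 + 'X + 1) ^+ posp (expA (p ^ l) k)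
       * ('X - 1) ^+ posp (expB (p ^ l) k) * D k).
Proof.
move=> pr_p le2k; have [K [w [chK w0]]] := exists_cube_root_field p pr_p.
have nq : [pchar K].-nat (p ^ l)%N.
  by rewrite (eq_pnat _ (pcharf_eq chK)) pnatX pnat_id.
move: (p ^ l)%N le2k nq => q le2k nq.
have [[a Ha] [b Hb]] : (exists a : nat, q%:Z - eps q = 3 * a%:Z) /\
                       (exists b : nat, q%:Z + 2 * eps q = 3 * b%:Z).
  have := divn_eq q 3; have := ltn_pmod q (isT : (0 < 3)%N); rewrite /eps.
  set s := (q %/ 3)%N; case: (q %% 3)%N => [|[|[|//]]] /= _ qE.
  - by split; exists s; lia.
  - by split; [exists s | exists s.+1]; lia.
  - by split; [exists s.+1 | exists s]; lia.
have chiq := char_poly_pascal_cyclotomic K _ _ _ w nq w0 Ha Hb.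
have posE (x : nat) : posp (x%:Z - k%:Z) = (x - k)%N.
  by rewrite /posp; case E: (_ - _) => [m|m]; lia.
have negE (x : nat) : negp (x%:Z - k%:Z) = (k - x)%N.
  by rewrite /negp; case E: (_ - _) => [m|m]; lia.
rewrite /expA /expB Ha Hb !mulKz // !posE !negE.
have lekn : (k <= q - k)%N by lia.
have schur := char_poly_pascal_schur K (q - k) k.
rewrite subnK in schur; last lia.
move: {schur}(schur nq lekn); rewrite chiq.
move: (q - k)%N => n schur i; rewrite (dvdz_pcharf chK) -coef_map /=.
have pascalE m : map_mx intr (Pmat m) = pascal_mx K m.
  by apply/matrixP => r c; rewrite !mxE.
have chiE : map_poly intr (chi n) = char_poly (pascal_mx K n).
  by rewrite map_char_poly pascalE.
have DE : map_poly intr (D k) = \det (('X^2)%:M + map_mx polyC (pascal_mx K k)).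
  rewrite -det_map_mx -pascalE; congr (\det _); apply/matrixP => r c.
  by rewrite !mxE rmorphD rmorphMn /= map_polyXn map_polyC.
suff e : map_poly intr (chi n * ('X^2 + 'X + 1) ^+ (k - a) * ('X - 1) ^+ (k - b))
   = map_poly (intr : int -> K) (('X^2 + 'X + 1) ^+ (a - k) * ('X - 1) ^+ (b - k) * D k).
  by rewrite rmorphB /= e subrr coef0.
rewrite !rmorphM !rmorphXn /= chiE DE rmorphB !rmorphD /= map_polyXn map_polyX !rmorph1.
have X3 : 'X^3 - 1 = ('X^2 + 'X + 1) * ('X - 1) :> {poly K} by ring.
have U0 : 'X^2 + 'X + 1 != 0 :> {poly K}.
  by apply: contra_neq (oner_neq0 K) => /(congr1 (coefp 0)); rewrite /= !coefE !add0r.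
have V0 : 'X - 1 != 0 :> {poly K} by rewrite -polyC1 polyXsubC_eq0.
move: schur; rewrite X3; move: ('X^2 + _ + 1) ('X - 1) U0 V0 => U V U0 V0 {X3}.
move: (char_poly _) (\det _) => F G schur.
(* These factors complete the truncated exponents a-k, k-a, b-k, k-b to a, k, b, k, which yields
   [schur]. *)
apply: (mulIf (expf_neq0 (minn a k) U0)); apply: (mulIf (expf_neq0 (minn b k) V0)).
have splitX (W : {poly K}) c d : W ^+ c = W ^+ (c - d) * W ^+ minn c d.
  by rewrite -exprD; congr (_ ^+ _); lia.
transitivity (F * (U * V) ^+ k).
  by rewrite exprMn (splitX U k a) (splitX V k b) !(minnC k); ring.
by rewrite schur (splitX U a k) (splitX V b k); ring.
Qed.
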